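(* For every integer $n \ge 1$, there exist a positive integer $k$ and a $k$-colourable weakly chordal graph $G$ such that $G$ is not $(k+n)$-mixing, i.e. the $(k+n)$-recolouring graph $\mathcal{R}_{k+n}(G)$ is disconnected.
   Context: All graphs are finite and simple. A $k$-colouring of $G$ is a map $\alpha: V(G) \to \{1,\dots,k\}$ with $\alpha(u) \ne \alpha(v)$ for every edge $uv$. The $k$-recolouring graph $\mathcal{R}_k(G)$ has the $k$-colourings of $G$ as vertices, two colourings being adjacent if they differ on exactly one vertex. $G$ is $k$-mixing if $\mathcal{R}_k(G)$ is connected. A hole is an induced chordless cycle on at least five vertices; an antihole is an induced subgraph whose complement is a hole. A graph is weakly chordal if it contains no hole and no antihole. *)

(* Defs.v *)
From mathcomp Require Import all_boot.
Set Implicit Arguments.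
Unset Strict Implicit.
Unset Printing Implicit Defensive.

Record sgraph := SGraph {
  vertex :> finType;
  edge : rel vertex;
  edge_sym : symmetric edge;
  edge_irrefl : irreflexive edge }.

Section Subgraphs.
Variable G : sgraph.

Definition compl_edge : rel G := fun x y => (x != y) && ~~ edge x y.

Fact compl_edge_sym : symmetric compl_edge.
Proof. by move=> x y; rewrite /compl_edge eq_sym edge_sym. Qed.

Fact compl_edge_irrefl : irreflexive compl_edge.
Proof. by move=> x; rewrite /compl_edge eqxx. Qed.

Definition compl : sgraph := SGraph compl_edge_sym compl_edge_irrefl.

Variable S : {set G}.

Definition induced_edge : rel {x : G | x \in S} :=
  fun x y => edge (val x) (val y).

Fact induced_edge_sym : symmetric induced_edge.
Proof. by move=> x y; rewrite /induced_edge edge_sym. Qed.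

Fact induced_edge_irrefl : irreflexive induced_edge.
Proof. by move=> x; rewrite /induced_edge edge_irrefl. Qed.

Definition induced : sgraph := SGraph induced_edge_sym induced_edge_irrefl.

End Subgraphs.

(* The whole graph H is a cycle: c lists every vertex once, and the edges are
   exactly the pairs that are consecutive in the cyclic order of c, so that the
   cycle is spanning and has no chord. *)
Definition is_long_cycle (H : sgraph) : Prop :=
  exists c : seq H,
    [/\ 5 <= size c, uniq c, forall x : H, x \in c &
        forall x y : H, edge x y = (y == next c x) || (x == next c y)].

Definition hole (G : sgraph) (S : {set G}) : Prop :=
  is_long_cycle (induced S).

Definition antihole (G : sgraph) (S : {set G}) : Prop :=
  is_long_cycle (compl (induced S)).

Definition weakly_chordal (G : sgraph) : Prop :=
  forall S : {set G}, ~ hole S /\ ~ antihole S.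

Section Colourings.
Variables (G : sgraph) (k : nat).

(* The colours 1, ..., k are represented by the elements 0, ..., k - 1 of 'I_k. *)
Definition proper_colouring (f : {ffun G -> 'I_k}) : bool :=
  [forall u, forall v, edge u v ==> (f u != f v)].

Definition colouring := {f : {ffun G -> 'I_k} | proper_colouring f}.

Definition colourable : Prop := inhabited colouring.

Definition recolour_edge : rel colouring :=
  fun a b => #|[set v : G | val a v != val b v]| == 1.

Fact recolour_edge_sym : symmetric recolour_edge.
Proof.
move=> a b; rewrite /recolour_edge; congr (#|pred_of_set _| == 1).
by apply/setP=> v; rewrite !inE eq_sym.
Qed.

Fact recolour_edge_irrefl : irreflexive recolour_edge.
Proof.
move=> a; rewrite /recolour_edge (_ : [set v | _] = set0) ?cards0 //.
by apply/setP=> v; rewrite !inE eqxx.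
Qed.

Definition recolouring_graph : sgraph :=
  SGraph recolour_edge_sym recolour_edge_irrefl.

End Colourings.

(* The graph with no vertex counts as connected; a recolouring graph is empty
   only when there is no colouring at all. *)
Definition connected_graph (G : sgraph) : Prop :=
  forall x y : G, connect (@edge G) x y.

Definition mixing (G : sgraph) (k : nat) : Prop :=
  connected_graph (recolouring_graph G k).

(* Main.v *)
(* A colouring is frozen if every vertex sees every colour but its own; it is
   then isolated in the recolouring graph.  The graph [base] has 12 vertices
   3 r + s (r < 4, s < 3), arranged in 4 rows and 3 columns which are all
   independent sets; its rows form a frozen 4-colouring and its columns a
   3-colouring, and it is weakly chordal.  In the join of n copies of [base] the
   rows form a frozen 4n-colouring and the columns a 3n-colouring, and
   4n = 3n + n.  A hole or an antihole of a join lies inside one copy, because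
   vertices of different copies are adjacent while the complement of a hole and
   that of an antihole are connected. *)
Require Import Defs.
From mathcomp Require Import all_boot.

Set Implicit Arguments.
Unset Strict Implicit.
Unset Printing Implicit Defensive.

(* Only pairs with [i < j] are constrained, which is enough for symmetric [r]. *)
Definition chordless_cycle (T : Type) (r : rel T) (m : nat) (x : nat -> T) :=
  5 <= m /\ forall i j, i < j < m ->
    r (x j) (x i) = (j == i.+1) || (i == 0) && (j.+1 == m).

Lemma long_cycle_chordless (H : sgraph) :
  is_long_cycle H -> exists m x, chordless_cycle (@edge H) m x.
Proof.
case=> [[|x0 c] [m5 Uc _ edgeE]] //; exists (size c).+1, (nth x0 (x0 :: c)).
split=> // i j /andP[ltij ltjm]; have ltim := ltn_trans ltij ltjm.
have nextE k : k <= size c ->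
    next (x0 :: c) (nth x0 (x0 :: c) k) = nth x0 (x0 :: c) (k.+1 %% (size c).+1).
  move=> le_kc; rewrite next_nth mem_nth // index_uniq //.
  case: (ltngtP k (size c)) le_kc => // [lt_kc | ->] _.
    by rewrite modn_small.
  (* Past the end of [c], [nth] returns its default [x0], which is also the first vertex: this
     closes the cycle. *)
  by rewrite modnn nth_default.
rewrite edgeE !nextE // !nth_uniq ?ltn_pmod //.
rewrite (modn_small (leq_ltn_trans ltij ltjm)) orbC; congr (_ || _).
move: ltjm; rewrite ltnS leq_eqVlt => /orP[/eqP-> | ltjc].
  by rewrite modnn eqxx andbT.
rewrite modn_small // eqSS [j == _]ltn_eqF // andbF.
by rewrite ltn_eqF // (ltn_trans ltij).
Qed.

Lemma weakly_chordal_chordless (G : sgraph) :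
    (forall m x, ~ chordless_cycle (@edge G) m x) ->
    (forall m x, ~ chordless_cycle (@compl_edge G) m x) ->
  weakly_chordal G.
Proof.
move=> nohole noanti S; split=> /long_cycle_chordless[m [x [m5 cycx]]].
  by apply: (nohole m (val \o x)).
by apply: (noanti m (val \o x)).
Qed.

Section Search.
Variables (r : rel nat) (V : seq nat).

(* Depth-first search for a chordless cycle of length at least 5 that extends
   the chordless path [x0 :: rev p]; running out of fuel returns [false].  The
   conditionals avoid [==>], whose arguments are both evaluated by [vm_compute]. *)
Fixpoint hole_free n x0 p :=
  if n is n'.+1 then
    all (fun y => if r y (head x0 p) && all (fun z => ~~ r y z) (behead p)
                  then if r y x0 then size p < 3 else hole_free n' x0 (y :: p)
                  else true) V
  else false.

(** One branch of the search follows the cycle itself. It fails when the cycle closes, or earlier if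
    the fuel runs out, so every [n] is sound. *)
Lemma hole_freeP n m x : chordless_cycle r m x -> (forall i, x i \in V) ->
  all (fun x0 => all (fun x1 => if r x1 x0 then hole_free n x0 [:: x1] else true) V) V = false.
Proof.
case=> m5 cycx Vx; apply/negP=> /allP/(_ _ (Vx 0))/allP/(_ _ (Vx 1)).
rewrite cycx /=; last by rewrite (leq_trans _ m5).
suff notfree k : 0 < k -> k.+1 < m ->
    ~~ hole_free n (x 0) (rev (map x (iota 1 k))).
  by apply/negP/(notfree 1); rewrite // (leq_trans _ m5).
elim: n k => //= n IHn [//|k] _ lt_km; apply/negP=> /allP/(_ _ (Vx k.+2)).
have rev_iotaS l : rev (map x (iota 1 l.+1)) = x l.+1 :: rev (map x (iota 1 l)).
  by rewrite -{1}[l.+1]addn1 iotaD map_cat rev_cat.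
have size_p : size (rev (map x (iota 1 k.+1))) = k.+1.
  by rewrite size_rev size_map size_iota.
rewrite size_p -rev_iotaS [in head _ _]rev_iotaS [in behead _]rev_iotaS.
rewrite [head _ _]/= [behead _]/= cycx ?ltnSn // eqxx [_ || _]/= andTb.
rewrite (_ : all _ _) //; last first.
  rewrite all_rev all_map; apply/allP=> i; rewrite mem_iota => /andP[i_gt0 lt_ik] /=.
  rewrite cycx; last by rewrite lt_km andbT ltnW // ltnS ltnW.
  by rewrite [i == 0]gtn_eqF // orbF eqSS gtn_eqF.
(* If [x k.+2] closes the cycle, the path [p] has [m - 2 >= 3] vertices and the test [size p < 3]
   fails. *)
rewrite cycx ?lt_km // orFb eqxx andTb; case: eqP => [mE | /eqP m_neq].
  by move: m5; rewrite -mE !ltnS ltnNge => /negP.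
apply/negP/IHn => //.
by rewrite ltn_neqAle m_neq.
Qed.

End Search.

Section Join.
Variables (n : nat) (B : sgraph).

Definition join_edge : rel ('I_n * B) :=
  fun p q => (p.1 != q.1) || edge p.2 q.2.

Fact join_edge_sym : symmetric join_edge.
Proof. by move=> p q; rewrite /join_edge eq_sym edge_sym. Qed.

Fact join_edge_irrefl : irreflexive join_edge.
Proof. by move=> p; rewrite /join_edge eqxx edge_irrefl. Qed.

Definition join : sgraph := SGraph join_edge_sym join_edge_irrefl.

Lemma chordless_cycle_join m (x : nat -> join) :
  chordless_cycle (@edge join) m x ->
  chordless_cycle (@edge B) m (fun i => (x i).2).
Proof.
case=> m5 cycx; split=> // i j ltijm.
(* Non-consecutive vertices of the cycle are not adjacent, hence share a copy. *)
have far a b : a.+1 < b < m -> (a == 0) && (b.+1 == m) = false ->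
    (x b).1 = (x a).1.
  case/andP=> ltab ltbm end_ab; apply/eqP/negPn/negP=> neq.
  have := cycx a b; rewrite ltbm (ltnW ltab) end_ab (gtn_eqF ltab).
  by rewrite /= /join_edge neq => /(_ isT).
(* x 1 and x (m - 1) are adjacent to x 0, but not to x 3 and x 2. *)
have same a : a < m -> (x a).1 = (x 0).1.
  have x2 : (x 2).1 = (x 0).1.
    by apply: far; rewrite /= ?ltn_eqF // (leq_trans _ m5).
  case: a => [|[|a]] // ltam.
    have <- : (x 3).1 = (x 0).1.
      by apply: far; rewrite /= ?ltn_eqF // (leq_trans _ m5).
    by apply/esym/far; rewrite /= ?(leq_trans _ m5).
  have [mE | m_neq] := eqVneq a.+3 m; last first.
    by apply: far; rewrite ?ltam //= (negbTE m_neq).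
  by rewrite -x2; apply: far => //; rewrite ltam andbT -ltnS mE.
have [ltij ltjm] := andP ltijm.
by rewrite -cycx //= /join_edge !same ?eqxx // (ltn_trans ltij).
Qed.

(** Complement edges never leave a copy, so induction along the cycle keeps it in the copy of
    [x 0]. *)
Lemma chordless_cycle_join_compl m (x : nat -> join) :
  chordless_cycle (@compl_edge join) m x ->
  chordless_cycle (@compl_edge B) m (fun i => (x i).2).
Proof.
case=> m5 cycx; split=> // i j ltijm.
have same a : a < m -> (x a).1 = (x 0).1.
  elim: a => // a IHa ltam; rewrite -IHa ?(ltnW ltam) //.
  have := cycx a a.+1; rewrite ltnSn eqxx => /(_ ltam) /andP[_].
  by rewrite /= /join_edge negb_or negbK => /andP[/eqP].
have [ltij ltjm] := andP ltijm; rewrite -cycx // /compl_edge /= /join_edge.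
have := same _ ltjm; rewrite -(same _ (ltn_trans ltij ltjm)).
by case: (x i) (x j) => [a u] [b v] /= ->; rewrite xpair_eqE eqxx.
Qed.

End Join.

(** The first step of a path from [a] to [b] would recolour a single vertex, but some neighbour has
    the new colour in [a] and keeps it. *)
Lemma frozen_not_mixing (G : sgraph) k (a b : colouring G k) : a <> b ->
    (forall v c, c != val a v -> exists2 u, edge v u & val a u = c) ->
  ~ mixing G k.
Proof.
move=> neq_ab frozen /(_ a b)/connectP[[|c p] /=]; first by move=> _ /esym.
case/andP=> /cards1P[v diff_ac] _ _.
have : val a v != val c v by move/setP/(_ v): diff_ac; rewrite !inE eqxx.
rewrite eq_sym => /frozen[u vu au].
have : val c u = val a u.
  apply/esym/eqP/negPn; move/setP/(_ u): diff_ac; rewrite !inE => ->.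
  by apply: contraTneq vu => ->; rewrite edge_irrefl.
rewrite au => cu; have /forallP/(_ v)/forallP/(_ u) := valP c.
by rewrite vu cu eqxx.
Qed.

(* Found by computer search. *)
Definition base_adj : seq (seq nat) :=
  [:: [:: 4; 5; 7; 11]; [:: 3; 6; 8; 9];  [:: 3; 6; 10];
      [:: 1; 2; 8; 10]; [:: 0; 6; 9; 11]; [:: 0; 7; 9];
      [:: 1; 2; 4; 10]; [:: 0; 5; 9; 11]; [:: 1; 3; 10];
      [:: 1; 4; 5; 7];  [:: 2; 3; 6; 8];  [:: 0; 4; 7]].

Definition base_rel : rel nat := fun i j => j \in nth [::] base_adj i.

Lemma base_all (P : pred nat) : all P (iota 0 12) -> forall i : 'I_12, P i.
Proof. by move=> /allP allP i; apply: allP; rewrite mem_iota ltn_ord. Qed.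

Lemma base_all2 (P : rel nat) :
  all (fun i => all (P i) (iota 0 12)) (iota 0 12) -> forall i j : 'I_12, P i j.
Proof. by move=> Pall i; apply/base_all/(base_all Pall i). Qed.

Definition base_edge : rel 'I_12 := fun i j => base_rel i j.

Fact base_edge_sym : symmetric base_edge.
Proof.
move=> i j; apply/eqP.
by apply: (@base_all2 (fun i j => base_rel i j == base_rel j i)).
Qed.

Fact base_edge_irrefl : irreflexive base_edge.
Proof.
move=> i; apply/negbTE.
by apply: (@base_all (fun i => ~~ base_rel i i)).
Qed.

Definition base : sgraph := SGraph base_edge_sym base_edge_irrefl.

Lemma base_no_hole m x : ~ chordless_cycle (@edge base) m x.
Proof.
move=> cycx; have Vx i : val (x i) \in iota 0 12 by rewrite mem_iota ltn_ord.
(* Fuel 12 suffices, since a chordless path in [base] has at most 12 vertices; the search evaluates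
   to [true]. *)
by have := hole_freeP (r := base_rel) 12 cycx Vx; vm_compute.
Qed.

Lemma base_no_antihole m x : ~ chordless_cycle (@compl_edge base) m x.
Proof.
move=> cycx; have Vx i : val (x i) \in iota 0 12 by rewrite mem_iota ltn_ord.
pose co i j := (i != j) && ~~ base_rel i j.
by have := hole_freeP (r := co) 12 cycx Vx; vm_compute.
Qed.

Lemma base_edge_rowcol (i j : base) :
  edge i j -> (i %/ 3 != j %/ 3) && (i %% 3 != j %% 3).
Proof.
by apply/implyP; apply: (@base_all2 (fun i j =>
  base_rel i j ==> (i %/ 3 != j %/ 3) && (i %% 3 != j %% 3))).
Qed.

(** This is what makes the row colouring of [base] frozen. *)
Lemma base_row_dominating (i : base) r :
  r < 4 -> r != i %/ 3 -> exists2 j : base, edge i j & j %/ 3 = r.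
Proof.
move=> lt_r4 neq_ri.
have /allP/(_ r) : all (fun r => (r != i %/ 3) ==>
    has (fun j => base_rel i j && (j %/ 3 == r)) (iota 0 12)) (iota 0 4).
  exact: (@base_all (fun i => all (fun r => (r != i %/ 3) ==>
    has (fun j => base_rel i j && (j %/ 3 == r)) (iota 0 12)) (iota 0 4))).
rewrite mem_iota lt_r4 neq_ri => /(_ isT)/hasP[j].
by rewrite mem_iota => /= ltj /andP[ij /eqP <-]; exists (Ordinal ltj).
Qed.

Section Colourings.
Variable n : nat.
Let G := join n base.

(** Each copy receives its own block of [d] colours, so only edges inside a copy depend on [f]. *)
Lemma join_colouring K d (f : base -> nat) : n * d <= K ->
    (forall i, f i < d) -> (forall i j : base, edge i j -> f i != f j) ->
  exists a : colouring G K, forall v, val (val a v) = v.1 * d + f v.2.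
Proof.
move=> le_K ltf propf.
have lt_K (v : G) : v.1 * d + f v.2 < K.
  by apply: leq_trans le_K; rewrite -ltn_divLR ?(leq_trans _ (ltf v.2)) //
    divnMDl ?(leq_trans _ (ltf v.2)) // divn_small // addn0.
have proper : proper_colouring [ffun v : G => Ordinal (lt_K v)].
  apply/forallP=> u; apply/forallP=> v; apply/implyP=> uv; rewrite !ffunE.
  apply: contraTneq uv => /(congr1 val) /= eq_uv.
  have d_gt0 := leq_ltn_trans (leq0n _) (ltf u.2).
  have eq1 : u.1 = v.1.
    apply: val_inj; have /(congr1 (divn^~ d)) := eq_uv.
    by rewrite /= !divnMDl // !divn_small // !addn0.
  rewrite /join_edge eq1 eqxx /=; apply/negP=> /propf.
  by move/eqP: eq_uv; rewrite eq1 eqn_add2l => ->.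
by exists (Sub _ proper) => v; rewrite SubK ffunE.
Qed.

Lemma base_col_colouring K : n * 3 <= K ->
  exists a : colouring G K, forall v, val (val a v) = v.1 * 3 + v.2 %% 3.
Proof.
move=> le_K; apply: (join_colouring (f := fun i => i %% 3)) => // [i | i j].
  exact: ltn_pmod.
by case/base_edge_rowcol/andP.
Qed.

Lemma base_row_colouring :
  exists a : colouring G (n * 3 + n), forall v, val (val a v) = v.1 * 4 + v.2 %/ 3.
Proof.
apply: (join_colouring (f := fun i => i %/ 3)) => [|i | i j].
- by rewrite mulnSr.
- by rewrite ltn_divLR.
by case/base_edge_rowcol/andP.
Qed.

Lemma join_not_mixing : 0 < n -> ~ mixing G (n * 3 + n).
Proof.
move=> n_gt0; have [a aE] := base_row_colouring.
have [b bE] := base_col_colouring (leq_addr n (n * 3)).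
apply: (@frozen_not_mixing _ _ a b) => [eq_ab | v c].
  (* Vertex 3 lies in row 1 and column 0, so the two colourings differ there. *)
  pose v i : G := (Ordinal n_gt0, inord i).
  by have := aE (v 3); rewrite eq_ab bE /= inordK.
rewrite -(inj_eq val_inj) aE => /= neq_c.
have lt_c : c %/ 4 < n by rewrite ltn_divLR // (leq_trans (ltn_ord c)) ?mulnSr.
(* Colour [c] belongs to row [c %% 4] of copy [c %/ 4]. *)
have [eq_copy | neq_copy] := eqVneq (c %/ 4) v.1.
  have [||j vj jE] := @base_row_dominating v.2 (c %% 4); first exact: ltn_pmod.
    by apply: contra_neq neq_c => <-; rewrite -eq_copy -divn_eq.
  exists (v.1, j); first by rewrite /= /join_edge vj orbT.
  by apply: val_inj; rewrite aE /= jE -eq_copy -divn_eq.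
(* In another copy any vertex of the row is adjacent to [v]; [c %% 4 * 3] is the one in column 0. *)
have ltj : c %% 4 * 3 < 12 by rewrite (@ltn_pmul2r 3 _ 4) // ltn_pmod.
exists (Ordinal lt_c, Ordinal ltj).
  by rewrite /= /join_edge -(inj_eq val_inj) /= eq_sym neq_copy.
by apply: val_inj; rewrite aE /= mulnK // -divn_eq.
Qed.

End Colourings.

Theorem theorem1 :
  forall n : nat, 1 <= n ->
  exists k : nat, 0 < k /\
  exists G : sgraph,
    [/\ colourable G k, weakly_chordal G & ~ mixing G (k + n)].
Proof.
move=> n n_gt0; exists (n * 3); split; first by rewrite muln_gt0 n_gt0.
exists (join n base); split; last exact: join_not_mixing.
  by have [a _] := base_col_colouring (leqnn (n * 3)); exists.
apply: weakly_chordal_chordless => m x.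
  by move/chordless_cycle_join/base_no_hole.
by move/chordless_cycle_join_compl/base_no_antihole.
Qed.
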